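(* Assume the standing hypotheses (H) and (L) below. For $i=1,2$ let $u_i\in W^{1,1}(0,T;X)$, $w_i\in W^{1,1}(0,T;W)$, $x_i^0\in Z(w_i(0))$, let $\xi_i\in W^{1,1}(0,T;X)$ be the solution of the sweeping process with inputs $(u_i,w_i)$ and initial condition $x_i^0$, and put $x_i=u_i-\xi_i$. Then for a.e. $t\in(0,T)$, $$\begin{aligned}|\dot\xi_1(t)-\dot\xi_2(t)|&+\frac1c\frac{\mathrm{d}}{\mathrm{d}t}\big|G(x_1(t),w_1(t))-G(x_2(t),w_2(t))\big|\le\frac1c\big(K_0|\dot u_1(t)-\dot u_2(t)|+K_1|\dot w_1(t)-\dot w_2(t)|_W\big)\\&+\frac1c\Big(2C_0|\dot u_1(t)|+\Big(C_1+\frac{C_0K_1}{c}\Big)|\dot w_1(t)|_W\Big)\big(|w_1(t)-w_2(t)|_W+|x_1(t)-x_2(t)|\big).\end{aligned}$$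
   Context: $T>0$. $X$ is a real Hilbert space with inner product $\langle\cdot,\cdot\rangle$ and norm $|x|=\sqrt{\langle x,x\rangle}$; $W$ is a real Banach space with norm $|\cdot|_W$, dual $W'$ (norm $|\cdot|_{W'}$) and duality pairing written $\langle v,f\rangle_W$ for $v\in W$, $f\in W'$. $G:X\times W\to[0,\infty)$ is locally Lipschitz continuous and $Z(w):=\{x\in X: G(x,w)\le 1\}$; $\partial Z(w)$ is its boundary and $\mathrm{dist}(x,S)=\inf_{s\in S}|x-s|$. Partial gradients: $\nabla_xG(x,w)\in X$ with $\langle\nabla_xG(x,w),y\rangle=\lim_{t\to0}\frac1t(G(x+ty,w)-G(x,w))$ for all $y\in X$; $\nabla_wG(x,w)\in W'$ with $\langle v,\nabla_wG(x,w)\rangle_W=\lim_{t\to0}\frac1t(G(x,w+tv)-G(x,w))$ for all $v\in W$. Hypothesis (H): $\nabla_xG(x,w)$ exists for all $x\in X$, $w\in W$, and there are positive constants $\lambda,c,L$ and functions $\mu_1:W\times[0,\infty)\to[0,\infty)$, $\mu_2:[0,\infty)\to[0,\infty)$ with $\mu_1(w,0)=\mu_2(0)=0$, $\lim_{s\to\infty}\mu_1(w,s)=\lim_{s\to\infty}\mu_2(s)=\infty$ for every $w$, such that: (i) $G(x,w)=1\Rightarrow|\nabla_xG(x,w)|\ge c$; (ii) $|\nabla_xG(x,w)-\nabla_xG(y,w)|\le\mu_1(w,|x-y|)$ for $x,y\in Z(w)$; (iii) $\langle\nabla_xG(x,w)-\nabla_xG(z,w),x-z\rangle\ge-\lambda|x-z|^2$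 for $x\in\partial Z(w)$, $z\in Z(w)$; (iv) $|G(x,w)-G(x,w')|\le L|w-w'|_W$; (v) for $\rho>0$: $\mathrm{dist}(x,Z(w))\ge\rho\Rightarrow G(x,w)-1\ge\mu_2(\rho)$ (all for all $x,y,z\in X$, $w,w'\in W$ as indicated). Set $r:=c/\lambda$. Hypothesis (L): $\nabla_xG(x,w)$ and $\nabla_wG(x,w)$ exist for all $(x,w)\in X\times W$, and there are positive constants $K_0,K_1,C_0,C_1$ with $|\nabla_xG(x,w)|\le K_0$, $|\nabla_wG(x,w)|_{W'}\le K_1$, $|\nabla_xG(x,w)-\nabla_xG(x',w')|\le C_0(|x-x'|+|w-w'|_W)$ and $|\nabla_wG(x,w)-\nabla_wG(x',w')|_{W'}\le C_1(|x-x'|+|w-w'|_W)$ for all $(x,w),(x',w')\in X\times W$. Sweeping process: given $u\in W^{1,1}(0,T;X)$, $w\in W^{1,1}(0,T;W)$, $x_0\in Z(w(0))$, a function $\xi\in W^{1,1}(0,T;X)$ is a solution with inputs $(u,w)$ and initial condition $x_0$ if, with $x:=u-\xi$: $x(t)\in Z(w(t))$ for all $t\in[0,T]$; $\langle x(t)-z,\dot\xi(t)\rangle+\frac{|\dot\xi(t)|}{2r}|x(t)-z|^2\ge0$ for all $z\in Z(w(t))$, a.e. $t\in(0,T)$; $x(0)=x_0$. *)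

(* Defs.v *)
From HB Require Import structures.
From mathcomp Require Import all_boot all_order all_algebra.
From mathcomp Require Import all_classical all_reals all_analysis.
Set Implicit Arguments. Unset Strict Implicit. Unset Printing Implicit Defensive.
Import Order.TTheory GRing.Theory Num.Theory.
Import numFieldNormedType.Exports.
Local Open Scope classical_set_scope.
Local Open Scope ring_scope.

Section Defs.
Variable R : realType.

Definition inner_product (X : normedModType R) (ip : X -> X -> R) : Prop :=
  [/\ forall x y, ip x y = ip y x,
      forall (a : R) x y z, ip (a *: x + y) z = a * ip x z + ip y z &
      forall x, `|x| ^+ 2 = ip x x].

Definition dual_elem (W : normedModType R) (f : W -> R) : Prop :=
  (forall (a : R) v v', f (a *: v + v') = a * f v + f v') /\
  exists K : R, forall v, `|f v| <= K * `|v|.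

Definition dual_norm_le (W : normedModType R) (f : W -> R) (K : R) : Prop :=
  forall v, `|f v| <= K * `|v|.

Definition locally_lipschitz2 (X W : normedModType R) (G : X -> W -> R) : Prop :=
  forall x w, exists2 r : R, 0 < r & exists K : R,
    forall x1 w1 x2 w2, `|x1 - x| < r -> `|w1 - w| < r ->
      `|x2 - x| < r -> `|w2 - w| < r ->
      `|G x1 w1 - G x2 w2| <= K * (`|x1 - x2| + `|w1 - w2|).

(* nabla_x G : partial Gateaux gradient, represented via Riesz in X *)
Definition is_grad_x (X W : normedModType R) (ip : X -> X -> R)
    (G : X -> W -> R) (gx : X -> W -> X) : Prop :=
  forall x w y,
    (fun t : R => t^-1 * (G (x + t *: y) w - G x w)) @ 0^' --> ip (gx x w) y.

(* nabla_w G : partial Gateaux gradient in W'; gw x w v = <v, nabla_w G(x,w)> *)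
Definition is_grad_w (X W : normedModType R)
    (G : X -> W -> R) (gw : X -> W -> W -> R) : Prop :=
  forall x w, dual_elem (gw x w) /\
    forall v, (fun t : R => t^-1 * (G x (w + t *: v) - G x w)) @ 0^' --> gw x w v.

Definition Zset (X W : Type) (G : X -> W -> R) (w : W) : set X :=
  [set x | G x w <= 1].

Definition bdry (T : topologicalType) (A : set T) : set T :=
  closure A `\` interior A.

(* dist(x, S) = inf_{s in S} |x - s|, in the extended reals (inf of empty = +oo) *)
Definition dist_set (X : normedModType R) (x : X) (S : set X) : \bar R :=
  ereal_inf [set (`|x - s|)%:E | s in S].

Definition abs_cont_on (V : normedModType R) (T : R) (f : R -> V) : Prop :=
  forall e : R, 0 < e -> exists2 d : R, 0 < d & forall (n : nat) (a b : nat -> R),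
    (forall k, (k < n)%N -> 0 <= a k /\ a k <= b k /\ b k <= T) ->
    (forall k, (k.+1 < n)%N -> b k <= a k.+1) ->
    \sum_(k < n) (b k - a k) < d ->
    \sum_(k < n) `|f (b k) - f (a k)| < e.

Definition W11 (V : normedModType R) (T : R) (f : R -> V) : Prop :=
  abs_cont_on T f /\
  {ae (@lebesgue_measure R), forall t, t \in `]0, T[ -> derivable f t 1}.

Definition sweeping_solution (X W : normedModType R) (ip : X -> X -> R)
    (G : X -> W -> R) (r T : R) (u : R -> X) (w : R -> W) (x0 : X)
    (xi : R -> X) : Prop :=
  [/\ W11 T xi,
      (forall t, t \in `[0, T] -> Zset G (w t) (u t - xi t)),
      {ae (@lebesgue_measure R), forall t, t \in `]0, T[ ->
         forall z, Zset G (w t) z ->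
         0 <= ip (u t - xi t - z) (derive1 xi t)
              + `|derive1 xi t| / (2 * r) * `|u t - xi t - z| ^+ 2} &
      u 0 - xi 0 = x0].

End Defs.

(* Main.v *)
(** Continuity of the partial gradients makes [G] Frechet differentiable, so
    [G (x_i, w_i)] is differentiable wherever the curves are.  Where
    [G (x_i, w_i) < 1] the velocity [xi_i'] vanishes.  Where [G (x_i, w_i) = 1] it
    is a nonnegative multiple of [a_i = nabla_x G (x_i, w_i)], and since
    [G (x_i, w_i)] is then maximal in time, [xi_i' = r_i a_i / |a_i|^2] with
    [r_i = <a_i, u_i'> + <w_i', nabla_w G (x_i, w_i)>].  If at most one of the two
    constraints is active, the sign of [G (x_1, w_1) - G (x_2, w_2)] makes the
    velocity and the derivative of the absolute value combine to at most
    [|r_1 - r_2| / c]; if both are active, that derivative vanishes and the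
    velocities are compared through the inversion [a |-> a / |a|^2].  The absolute
    value fails to be differentiable only at simple zeros, which are isolated and
    hence countably many. *)
Require Import Defs.
From HB Require Import structures.
From mathcomp Require Import all_boot all_order all_algebra.
From mathcomp Require Import all_classical all_reals all_analysis.
From mathcomp Require Import ring lra.
Set Implicit Arguments.
Unset Strict Implicit.
Unset Printing Implicit Defensive.
Import Order.TTheory GRing.Theory Num.Theory.
Import numFieldNormedType.Exports.
Local Open Scope classical_set_scope.
Local Open Scope ring_scope.

Lemma is_derive_cvgP {R : numFieldType} {V W : normedModType R} (f : V -> W)
    (a v : V) (l : W) :
  is_derive a v f l <-> h^-1 *: (f (h *: v + a) - f a) @[h --> 0^'] --> l.
Proof.
split=> [[df <-]|fl]; first exact: df.
by apply: DeriveDef; [exact: cvgP fl|exact: cvg_lim fl].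
Qed.

Lemma is_derive_line {R : numFieldType} {V W : normedModType R} (f : V -> W)
    (a v : V) (s : R) (l : W) :
  is_derive (a + s *: v) v f l -> is_derive s 1 (fun r => f (a + r *: v)) l.
Proof.
move=> /is_derive_cvgP fl; apply/is_derive_cvgP; apply: cvg_trans fl.
apply: near_eq_cvg; apply: nearW => h.
by rewrite [h *: 1]mulr1 scalerDl addrCA.
Qed.

Lemma is_derive1_continuous {R : numFieldType} {V : normedModType R}
    (f : R -> V) (t : R) (l : V) :
  is_derive t 1 f l -> {for t, continuous f}.
Proof. by case=> /derivable1_diffP/differentiable_continuous. Qed.

Lemma is_derive_near_lt {R : realFieldType} {V : normedModType R} (f : V -> R)
    (a v : V) (l b : R) :
  is_derive a v f l -> f a < b -> \forall s \near (0 : R), f (a + s *: v) < b.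
Proof.
rewrite -[a in is_derive a]addr0 -[in X in is_derive X](scale0r v).
move=> /is_derive_line/is_derive1_continuous/cvgr_lt /= fc fab.
by apply: fc; rewrite scale0r addr0.
Qed.

Lemma mean_value_segment {R : realType} {V : normedModType R} (f : V -> R)
    (df : V -> R) (a v : V) :
  (forall x, is_derive x v f (df x)) ->
  exists2 s : R, 0 <= s <= 1 & f (a + v) - f a = df (a + s *: v).
Proof.
move=> fd.
have fd1 (s : R) : is_derive s 1 (fun r => f (a + r *: v)) (df (a + s *: v)).
  exact: is_derive_line.
have fc : {within `[0, 1], continuous (fun r : R => f (a + r *: v))}.
  by apply: derivable_within_continuous => s _; case: (fd1 s).
have [s s01] := MVT_segment ler01 (fun s _ => fd1 s) fc.
rewrite scale1r scale0r addr0 subr0 mulr1 => ->.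
by exists s => //; rewrite in_itv /= in s01.
Qed.

Lemma is_derive_local_max {R : realFieldType} {V : normedModType R} (f : V -> R)
    (a v : V) (l : R) :
  is_derive a v f l -> (\forall x \near a, f x <= f a) -> l = 0.
Proof.
move=> /is_derive_cvgP fl fmax.
have line_cvg : h *: v + a @[h --> (0 : R)] --> a.
  rewrite -[X in _ --> X]add0r -(scale0r v).
  by apply: cvgD; [apply: cvgZ; [exact: cvg_id|exact: cvg_cst]|apply: cvg_cst].
have fmax0 : \forall h \near (0 : R), f (h *: v + a) <= f a.
  exact: (line_cvg _ fmax).
apply/le_anti/andP; split.
- apply: (cvgr_to_le (cvg_dnbhs_at_right fl)); near=> h.
  rewrite pmulr_rle0 ?invr_gt0 // subr_le0.
  by near: h; exact: cvg_within fmax0.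
- apply: (cvgr_to_ge (cvg_dnbhs_at_left fl)); near=> h.
  rewrite nmulr_rge0 ?invr_lt0 // subr_le0.
  by near: h; exact: cvg_within fmax0.
Unshelve. all: by end_near. Qed.

Lemma is_derive_normr {R : realFieldType} (f : R -> R) (t l : R) :
  is_derive t 1 f l -> (f t = 0 -> l = 0) ->
  is_derive t 1 (fun s => `|f s|) (Num.sg (f t) * l).
Proof.
move=> fl l0; have fc := is_derive1_continuous fl.
have [ft|ft|ft] := ltrgt0P (f t).
- rewrite gtr0_sg // mul1r; apply: near_eq_is_derive fl.
  by near=> s; rewrite gtr0_norm //; near: s; exact: cvgr_gt fc _ ft.
- rewrite ltr0_sg // mulN1r; apply: near_eq_is_derive (is_deriveN fl).
  by near=> s; rewrite ltr0_norm //; near: s; exact: cvgr_lt fc _ ft.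
- rewrite ft sgr0 mul0r; move/is_derive_cvgP: fl; rewrite (l0 ft) => fl.
  apply/is_derive_cvgP/cvgr0Pnorm_lt => e e0.
  move/cvgr0Pnorm_lt: fl => /(_ e e0); apply: filterS => h.
  by rewrite ft normr0 !subr0 !normrZ normr_id.
Unshelve. all: by end_near. Qed.

Lemma isolated_simple_zero {R : realFieldType} (f : R -> R) (t l : R) :
  is_derive t 1 f l -> l != 0 -> f t = 0 -> isolated [set s | f s = 0] t.
Proof.
move=> /is_derive_cvgP fl l0 ft; split; first by rewrite inE.
have : \forall h \near 0^', f (h + t) != 0.
  have : \forall h \near 0^', h^-1 *: (f (h *: 1 + t) - f t) != 0.
    exact: cvgr_neq0 fl l0.
  apply: filterS => h; rewrite [h *: 1]mulr1; apply: contra_neq => ->.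
  by rewrite ft subrr scaler0.
move=> /nbhs_ballP[e /= e0 fe]; exists (ball t e); first exact: nbhsx_ballx.
apply/seteqP; split=> s /=; last by move=> ->; split=> //; exact: ballxx.
move=> [ts fs]; apply/eqP; rewrite -subr_eq0; apply: contraPT fs => st.
have := fe (s - t); rewrite subrK => /(_ _ st)/eqP; apply.
by move: ts; rewrite -!ball_normE /= sub0r opprB.
Qed.

Lemma ae_derive_eq0_at_zeros {R : realType} (f : R -> R) :
  {ae (@lebesgue_measure R), forall t, forall l : R,
    is_derive (t : R) 1 f l -> f t = 0 -> l = 0}.
Proof.
have : (@lebesgue_measure R).-negligible (isolated [set t | f t = 0]).
  have cS := countable_isolated [set t | f t = 0].
  apply/negligibleP; first exact: countable_measurable.
  exact: countable_lebesgue_measure0.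
apply: negligibleS => t /existsNP[l] /not_implyP[fl] /not_implyP[ft /eqP l0].
exact: isolated_simple_zero fl l0 ft.
Qed.

Lemma ae_is_derive1 {R : realType} {V : normedModType R} (T : R) (f : R -> V) :
  W11 T f ->
  {ae (@lebesgue_measure R), forall t, t \in `]0, T[ ->
    is_derive t 1 f (derive1 f t)}.
Proof.
case=> _; apply: (filterS (Filter := ae_filter_ringOfSetsType _)) => t fd /fd ft.
by rewrite derive1E; exact: derivableP.
Qed.

Lemma dual_elem_linear {R : realType} {V : normedModType R} (f : V -> R) :
  dual_elem f -> exists2 l : {linear V -> R}, continuous l & f = l.
Proof.
move=> [flin [K fK]].
pose l : {linear V -> R} := HB.pack f (GRing.isLinear.Build R V R *%R f flin).
exists l => //; apply/linear_bounded_continuous/linear_boundedP.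
exists K; split=> [|M KM x]; first exact: num_real.
by rewrite (le_trans (fK x)) // ler_wpM2r // ltW.
Qed.

Lemma is_diff_littleo {R : realType} {V W : normedModType R} (f : V -> W)
    (df : {linear V -> W}) (a : V) :
  continuous df ->
  (forall e, 0 < e ->
    \forall v \near 0, `|f (v + a) - f a - df v| <= e * `|v|) ->
  is_diff a f df.
Proof.
move=> dfc f_o.
have fE : f \o shift a = cst (f a) + df +o_ 0 id.
  apply/eqaddoP => e /f_o; apply: filterS => v.
  by rewrite /= !fctE opprD addrA.
have dE := diff_unique dfc fE.
by apply: DiffDef => //; apply/diff_locallyP; rewrite dE.
Qed.

Lemma normrZ_le {R : numFieldType} {V : normedModType R} (v : V) (s : R) :
  0 <= s <= 1 -> `|s *: v| <= `|v|.
Proof. by move=> /andP[s0 s1]; rewrite normrZ ger0_norm // ler_piMl. Qed.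

Lemma is_diff_continuous_partials {R : realType} {X W : normedModType R}
    (G : X -> W -> R) (dx : X -> W -> X -> R) (dw : X -> W -> W -> R)
    (x0 : X) (w0 : W) :
  (forall x w p, is_derive x p (G^~ w) (dx x w p)) ->
  (forall x w q, is_derive w q (G x) (dw x w q)) ->
  dual_elem (dx x0 w0) -> dual_elem (dw x0 w0) ->
  (forall e, 0 < e -> \forall z \near (x0, w0),
    dual_norm_le (fun p => dx z.1 z.2 p - dx x0 w0 p) e /\
    dual_norm_le (fun q => dw z.1 z.2 q - dw x0 w0 q) e) ->
  is_diff (x0, w0) (fun z => G z.1 z.2) (fun v => dx x0 w0 v.1 + dw x0 w0 v.2).
Proof.
move=> Gx Gw /dual_elem_linear[lx lxc lxE] /dual_elem_linear[lw lwc lwE] d_cont.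
pose l : {linear (X * W)%type -> R} := (lx \o fst) \+ (lw \o snd).
have -> : (fun v => dx x0 w0 v.1 + dw x0 w0 v.2) = l by rewrite lxE lwE.
apply: is_diff_littleo => [z|e e0].
  apply: cvgD; apply: continuous_comp.
  - exact: cvg_fst.
  - exact: lxc.
  - exact: cvg_snd.
  - exact: lwc.
have e2_gt0 : 0 < e / 2 by rewrite divr_gt0.
have /nbhs_ballP[r /= r_gt0 d_close] := d_cont _ e2_gt0.
apply/nbhs_ballP; exists r => //= -[p q].
rewrite -ball_normE /= sub0r normrN (addrC p) (addrC q) => pq_lt_r.
have d_close_pq p' q' : `|p'| <= `|p| -> `|q'| <= `|q| ->
    dual_norm_le (fun v => dx (x0 + p') (w0 + q') v - dx x0 w0 v) (e / 2) /\
    dual_norm_le (fun v => dw (x0 + p') (w0 + q') v - dw x0 w0 v) (e / 2).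
  move=> pp qq; apply: (d_close (x0 + p', w0 + q')).
  rewrite -ball_normE /=; apply: le_lt_trans pq_lt_r.
  rewrite -[_ - _]/(x0 - (x0 + p'), w0 - (w0 + q')) !opprD !addNKr.
  by rewrite !prod_normE /= !normrN ge_max !le_max pp qq orbT.
have [s s01 Gs] := mean_value_segment x0 (fun x => Gx x (w0 + q) p).
have [t t01 Gt] := mean_value_segment w0 (fun w => Gw x0 w q).
have [dx_close _] := d_close_pq _ _ (normrZ_le p s01) (lexx _).
have zero_le : `|0 : X| <= `|p| by rewrite normr0.
have [_ dw_close] := d_close_pq _ _ zero_le (normrZ_le q t01).
have -> : G (x0 + p) (w0 + q) - G x0 w0 - (lx p + lw q) =
    (dx (x0 + s *: p) (w0 + q) p - dx x0 w0 p) +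
    (dw (x0 + 0) (w0 + t *: q) q - dw x0 w0 q).
  by rewrite addr0 -Gs -Gt lxE lwE; ring.
rewrite (le_trans (ler_normD _ _)) // [e]splitr mulrDl.
by apply: lerD; [apply: le_trans (dx_close p) _|apply: le_trans (dw_close q) _];
  rewrite ler_pM2l // prod_normE /= le_max lexx ?orbT.
Qed.

Lemma is_derive1_is_diff {R : numFieldType} {V : normedModType R} (f : R -> V)
    (t : R) (l : V) :
  is_derive t 1 f l -> is_diff t f ( *:%R^~ l).
Proof.
case=> fd <-; apply: DiffDef; first exact/derivable1_diffP.
by rewrite deriv1E // derive1E.
Qed.

Lemma is_diff_is_derive {R : numFieldType} {V W : normedModType R} (f df : V -> W)
    (a v : V) :
  is_diff a f df -> is_derive a v f (df v).
Proof.
by case=> fd <-; apply: DeriveDef; [exact: diff_derivable|exact: deriveE].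
Qed.

Lemma is_derive_grad_x {R : realType} {X W : normedModType R} (ip : X -> X -> R)
    (G : X -> W -> R) (gx : X -> W -> X) :
  is_grad_x ip G gx -> forall x w p, is_derive x p (G^~ w) (ip (gx x w) p).
Proof.
move=> gx_grad x w p; apply/is_derive_cvgP; apply: cvg_trans (gx_grad x w p).
by apply: near_eq_cvg; apply: nearW => t; rewrite (addrC _ (t *: _)).
Qed.

Lemma is_derive_grad_w {R : realType} {X W : normedModType R}
    (G : X -> W -> R) (gw : X -> W -> W -> R) :
  is_grad_w G gw -> forall x w q, is_derive w q (G x) (gw x w q).
Proof.
move=> gw_grad x w q; apply/is_derive_cvgP; have [_ /(_ q)] := gw_grad x w.
apply: cvg_trans; apply: near_eq_cvg; apply: nearW => t.
by rewrite (addrC _ (t *: _)).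
Qed.

Definition proximal_normal {R : realType} {X : normedModType R} (ip : X -> X -> R)
    (Z : set X) (k : R) (x v : X) : Prop :=
  forall z, Z z -> 0 <= ip (x - z) v + k * `|x - z| ^+ 2.

Definition inversion {R : realType} {X : normedModType R} (a : X) : X :=
  `|a| ^- 2 *: a.

Lemma normr_inversion {R : realType} {X : normedModType R} (a : X) :
  `|inversion a| = `|a|^-1.
Proof.
have [->|a0] := eqVneq a 0; first by rewrite /inversion scaler0 normr0 invr0.
rewrite normrZ ger0_norm ?invr_ge0 ?exprn_ge0 //.
by field; rewrite normr_eq0.
Qed.

Section inner_product.
Context {R : realType} {X : normedModType R} {ip : X -> X -> R}.
Hypothesis ip_inner : inner_product ip.

Lemma ipC x y : ip x y = ip y x.
Proof. by case: ip_inner. Qed.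

Lemma ipxx x : ip x x = `|x| ^+ 2.
Proof. by case: ip_inner. Qed.

Lemma ip_bilinear : bilinear_for *%R *%R ip.
Proof.
have [_ ipl _] := ip_inner.
by split=> z a x y; [exact: ipl|rewrite !(ipC z); exact: ipl].
Qed.

HB.instance Definition _ :=
  bilinear_isBilinear.Build R X X R *%R *%R ip ip_bilinear.

Lemma ipDl x y z : ip (x + y) z = ip x z + ip y z. Proof. exact: linearDl. Qed.
Lemma ipDr z x y : ip z (x + y) = ip z x + ip z y. Proof. exact: linearDr. Qed.
Lemma ipNl x z : ip (- x) z = - ip x z. Proof. exact: linearNl. Qed.
Lemma ipNr z x : ip z (- x) = - ip z x. Proof. exact: linearNr. Qed.
Lemma ipBl x y z : ip (x - y) z = ip x z - ip y z. Proof. exact: linearBl. Qed.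
Lemma ipBr z x y : ip z (x - y) = ip z x - ip z y. Proof. exact: linearBr. Qed.
Lemma ipZl a x z : ip (a *: x) z = a * ip x z. Proof. exact: linearZl_LR. Qed.
Lemma ipZr a z x : ip z (a *: x) = a * ip z x. Proof. exact: linearZr_LR. Qed.
Lemma ip0r z : ip z 0 = 0. Proof. exact: linear0r. Qed.

Definition ipE := (ipDl, ipDr, ipNl, ipNr, ipZl, ipZr).

Lemma ip_cauchy_schwarz x y : `|ip x y| <= `|x| * `|y|.
Proof.
have [->|y0] := eqVneq y 0; first by rewrite ip0r !normr0 mulr0.
have y2_gt0 : 0 < `|y| ^+ 2 by rewrite exprn_gt0 // normr_gt0.
rewrite -ler_sqr ?nnegrE ?mulr_ge0 // real_normK ?num_real // exprMn.
rewrite -subr_ge0 -(pmulr_rge0 _ y2_gt0).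
have := sqr_ge0 `|(`|y| ^+ 2) *: x - ip x y *: y|.
by rewrite -(ipxx (_ - _)) !ipE !ipxx (ipC y x); congr (_ <= _); ring.
Qed.

Lemma dual_elem_ip x : dual_elem (ip x).
Proof.
split=> [a y z|]; first by rewrite !ipE.
by exists `|x| => y; exact: ip_cauchy_schwarz.
Qed.

Lemma proximal_normal_tangent_le0 (Z : set X) (k : R) (x v y : X) :
  proximal_normal ip Z k x v -> (\forall s \near 0^'+, Z (x + s *: y)) ->
  ip y v <= 0.
Proof.
move=> Zv Zy.
have sk0 : s * (k * `|y| ^+ 2) @[s --> 0^'+] --> 0.
  rewrite -[X in _ --> X](mul0r (k * `|y| ^+ 2)).
  by apply: cvgM; [exact: cvg_within|exact: cvg_cst].
apply: (cvgr_to_ge sk0); near=> s.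
have s0 : 0 < s by [].
have /Zv : Z (x + s *: y) by near: s.
rewrite opprD addNKr ipNl normrN ipZl normrZ (gtr0_norm s0) exprMn.
by move=> Zxsy; rewrite -(ler_pM2l s0); lra.
Unshelve. all: by end_near. Qed.

Lemma proximal_normal_eq0 (Z : set X) (k : R) (x v : X) :
  proximal_normal ip Z k x v -> (\forall s \near 0^'+, Z (x + s *: v)) -> v = 0.
Proof.
move=> Zv /(proximal_normal_tangent_le0 Zv); rewrite ipxx => v0.
by apply/normr0_eq0/eqP; rewrite -sqrf_eq0 eq_le v0 sqr_ge0.
Qed.

Lemma proximal_normal_strict_sublevel (F : X -> R) (b k l : R) (x v : X) :
  is_derive x v F l -> F x < b -> proximal_normal ip [set z | F z <= b] k x v ->
  v = 0.
Proof.
move=> Fd Fx Zv; apply: (proximal_normal_eq0 Zv); apply: cvg_within.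
by apply: filterS (is_derive_near_lt Fd Fx) => s /ltW.
Qed.

Lemma polar_open_halfspace (a v : X) :
  a != 0 -> (forall y, ip a y < 0 -> ip y v <= 0) ->
  exists2 m : R, 0 <= m & v = m *: a.
Proof.
move=> a0 polar.
have a2_gt0 : 0 < `|a| ^+ 2 by rewrite exprn_gt0 // normr_gt0.
have av_ge0 : 0 <= ip a v.
  have := polar (- a); rewrite ipNr ipNl ipxx oppr_lt0 oppr_le0; exact.
exists (ip a v / `|a| ^+ 2); first by rewrite divr_ge0 // ltW.
set m := _ / _; pose p := v - m *: a.
have ap : ip a p = 0 by rewrite !ipE ipxx divfK ?subrr // gt_eqF.
have pv : ip p v = `|p| ^+ 2.
  by rewrite -ipxx [in RHS]/p ipBr ipZr (ipC p a) ap mulr0 subr0.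
have p_small e : 0 < e -> `|p| ^+ 2 <= e * ip a v.
  move=> e0; have := polar (p - e *: a).
  rewrite ipBr ipZr ap ipxx sub0r oppr_lt0 mulr_gt0 // => /(_ isT).
  by rewrite ipBl ipZl pv subr_le0.
have p2_le0 : `|p| ^+ 2 <= 0.
  apply/ler_addgt0Pl => e e0; rewrite addr0.
  have av1_gt0 : 0 < ip a v + 1 by rewrite ltr_wpDl.
  apply: (le_trans (p_small (e / (ip a v + 1)) _)); first by rewrite divr_gt0.
  by rewrite mulrAC ler_pdivrMr // ler_pM2l // lerDl.
apply/eqP; rewrite -subr_eq0 -/p -normr_eq0 -sqrf_eq0 eq_le p2_le0.
exact: sqr_ge0.
Qed.

Lemma proximal_normal_sublevel (F : X -> R) (b k : R) (x v a : X) :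
  (forall y, is_derive x y F (ip a y)) -> a != 0 -> F x <= b ->
  proximal_normal ip [set z | F z <= b] k x v ->
  exists2 m : R, 0 <= m & v = m *: a.
Proof.
move=> Fd a0 Fx Zv; apply: polar_open_halfspace => // y ay.
apply: (proximal_normal_tangent_le0 Zv); near=> s => /=.
have s0 : 0 < s by [].
have : s^-1 *: (F (s *: y + x) - F x) < 0.
  near: s; apply: cvgr_lt ay; apply: cvg_dnbhs_at_right.
  exact/is_derive_cvgP.
by rewrite pmulr_rlt0 ?invr_gt0 // subr_lt0 addrC => /ltW /le_trans; exact.
Unshelve. all: by end_near. Qed.

Lemma dist_inversion (a b : X) : a != 0 -> b != 0 ->
  `|inversion a - inversion b| = `|a - b| / (`|a| * `|b|).
Proof.
move=> a0 b0; apply/eqP; rewrite -(@eqrXn2 _ 2) ?divr_ge0 ?mulr_ge0 //.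
apply/eqP; rewrite exprMn exprVn -(ipxx (_ - _)) -(ipxx (a - b)) !ipE !ipxx.
rewrite (ipC b a).
by field; rewrite !normr_eq0 a0 b0.
Qed.

Lemma dist_scaled_inversion_le (a b : X) (s t : R) : a != 0 -> b != 0 ->
  `|s *: inversion a - t *: inversion b| <=
  `|s| / `|a| * (`|a - b| / `|b|) + `|s - t| / `|b|.
Proof.
move=> a0 b0.
have -> : s *: inversion a - t *: inversion b =
    s *: (inversion a - inversion b) + (s - t) *: inversion b.
  by rewrite scalerBr scalerBl addrA subrK.
rewrite (le_trans (ler_normD _ _)) // normrZ (normrZ _ (inversion b)).
by rewrite dist_inversion // normr_inversion invfM mulrACA mulrA.
Qed.

End inner_product.

Definition total_diff {R : realType} {X W : normedModType R} (ip : X -> X -> R)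
    (gx : X -> W -> X) (gw : X -> W -> W -> R)
    (x : X) (w : W) (p : X) (q : W) : R :=
  ip (gx x w) p + gw x w q.

(* In the active case the velocity is [m *: gx x w], and stationarity of the
   constraint, [total_diff x w (du - m *: gx x w) dw = 0], determines [m]. *)
Definition velocity_law {R : realType} {X W : normedModType R} (ip : X -> X -> R)
    (G : X -> W -> R) (gx : X -> W -> X) (gw : X -> W -> W -> R)
    (x : X) (w : W) (du : X) (dw : W) (dxi : X) : Prop :=
  (G x w < 1 /\ dxi = 0) \/
  [/\ G x w = 1, 0 <= total_diff ip gx gw x w du dw &
      dxi = total_diff ip gx gw x w du dw *: inversion (gx x w)].

Section sweeping.
Context {R : realType} {X W : normedModType R} {ip : X -> X -> R}.
Context {G : X -> W -> R} {gx : X -> W -> X} {gw : X -> W -> W -> R}.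
Context {c K0 K1 C0 C1 : R}.

Local Notation dG := (total_diff ip gx gw).
Local Notation law := (velocity_law ip G gx gw).

Hypotheses (ip_inner : inner_product ip) (c_gt0 : 0 < c).
Hypotheses (gx_grad : is_grad_x ip G gx) (gw_grad : is_grad_w G gw).
Hypothesis gx_ge : forall x w, G x w = 1 -> c <= `|gx x w|.
Hypothesis gx_le : forall x w, `|gx x w| <= K0.
Hypothesis gw_le : forall x w, dual_norm_le (gw x w) K1.
Hypothesis gx_lip :
  forall x w x' w', `|gx x w - gx x' w'| <= C0 * (`|x - x'| + `|w - w'|).
Hypothesis gw_lip : forall x w x' w',
  dual_norm_le (fun v => gw x w v - gw x' w' v) (C1 * (`|x - x'| + `|w - w'|)).

Lemma is_diff_constraint x w :
  is_diff (x, w) (fun z => G z.1 z.2) (fun v => dG x w v.1 v.2).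
Proof.
have [gw_dual _] := gw_grad x w.
apply: (@is_diff_continuous_partials _ _ _ _ (fun x w => ip (gx x w)) gw) => //.
- exact: is_derive_grad_x.
- exact: is_derive_grad_w.
- exact: dual_elem_ip.
move=> e e0.
have dist0 C : C * (`|z.1 - x| + `|z.2 - w|) @[z --> (x, w)] --> 0.
  rewrite -[X in _ --> X](mulr0 C); apply: cvgM; first exact: cvg_cst.
  rewrite -[X in _ --> X](addr0 0) -{1}(@normr0 _ X) -(@normr0 _ W).
  rewrite -(subrr x) -(subrr w).
  by apply: cvgD; apply: cvg_norm; apply: cvgB;
    by [exact: cvg_fst|exact: cvg_snd|exact: cvg_cst].
near=> z.
have gx_close : C0 * (`|z.1 - x| + `|z.2 - w|) <= e.
  by near: z; exact: cvgr_le (dist0 C0) _ e0.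
have gw_close : C1 * (`|z.1 - x| + `|z.2 - w|) <= e.
  by near: z; exact: cvgr_le (dist0 C1) _ e0.
split=> v.
  rewrite -(ipBl ip_inner) (le_trans (ip_cauchy_schwarz ip_inner _ _)) //.
  rewrite ler_wpM2r //.
  exact: le_trans (gx_lip _ _ _ _) gx_close.
by rewrite (le_trans (gw_lip _ _ _ _ _)) // ler_wpM2r.
Unshelve. all: by end_near. Qed.

Lemma is_derive_constraint {x : R -> X} {w : R -> W} {t : R} {dx : X} {dw : W} :
  is_derive t 1 x dx -> is_derive t 1 w dw ->
  is_derive t 1 (fun s => G (x s) (w s)) (dG (x t) (w t) dx dw).
Proof.
move=> /is_derive1_is_diff xd /is_derive1_is_diff wd.
have Gd := is_diff_comp (is_diff_pair xd wd) (is_diff_constraint (x t) (w t)).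
by have := is_diff_is_derive (1 : R) Gd; rewrite /= !scale1r.
Qed.

Lemma total_diff_subr_inversion x w du dw : gx x w != 0 ->
  dG x w (du - dG x w du dw *: inversion (gx x w)) dw = 0.
Proof.
move=> a0.
rewrite /total_diff (ipBr ip_inner) !(ipZr ip_inner) (ipxx ip_inner).
by rewrite mulVf ?sqrf_eq0 ?normr_eq0 //; ring.
Qed.

Lemma stationary_normal_velocity x w du dw dxi m :
  gx x w != 0 -> 0 <= m -> dxi = m *: gx x w -> dG x w (du - dxi) dw = 0 ->
  0 <= dG x w du dw /\ dxi = dG x w du dw *: inversion (gx x w).
Proof.
move=> a0 m0 ->.
rewrite /total_diff (ipBr ip_inner) (ipZr ip_inner) (ipxx ip_inner) => stationary.
have -> : ip (gx x w) du + gw x w dw = m * `|gx x w| ^+ 2 by lra.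
by rewrite mulr_ge0 // scalerA mulfK // sqrf_eq0 normr_eq0.
Qed.

Lemma sweeping_velocity_law (u xi : R -> X) (w : R -> W) (t k : R)
    (du dxi : X) (dw : W) :
  is_derive t 1 u du -> is_derive t 1 xi dxi -> is_derive t 1 w dw ->
  (\forall s \near t, G (u s - xi s) (w s) <= 1) ->
  proximal_normal ip (Zset G (w t)) k (u t - xi t) dxi ->
  law (u t - xi t) (w t) du dw dxi.
Proof.
move=> ud xid wd G_le1 normal; have Gt := nbhs_singleton G_le1.
have grad := is_derive_grad_x gx_grad (u t - xi t) (w t).
have [G1|G1] := eqVneq (G (u t - xi t) (w t)) 1; last first.
  have {}G1 : G (u t - xi t) (w t) < 1 by rewrite lt_neqAle G1.
  left; split=> //.
  exact: (proximal_normal_strict_sublevel ip_inner (grad dxi) G1 normal).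
have a0 : gx (u t - xi t) (w t) != 0.
  by rewrite -normr_gt0 (lt_le_trans c_gt0) // gx_ge.
have [m m0 dxiE] := proximal_normal_sublevel ip_inner grad a0 Gt normal.
have stationary : dG (u t - xi t) (w t) (du - dxi) dw = 0.
  apply: is_derive_local_max (is_derive_constraint (is_deriveB ud xid) wd) _.
  by rewrite /= G1.
by right; have [] := stationary_normal_velocity a0 m0 dxiE stationary.
Qed.

Lemma total_diff_le x w p q : `|dG x w p q| <= `|gx x w| * `|p| + K1 * `|q|.
Proof.
rewrite (le_trans (ler_normD _ _)) // lerD //; first exact: ip_cauchy_schwarz.
exact: gw_le.
Qed.

Lemma total_diff_dist_le x1 w1 x2 w2 p1 q1 p2 q2 :
  `|dG x1 w1 p1 q1 - dG x2 w2 p2 q2| <=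
  K0 * `|p1 - p2| + K1 * `|q1 - q2| +
  (C0 * `|p1| + C1 * `|q1|) * (`|x1 - x2| + `|w1 - w2|).
Proof.
have [gw_dual _] := gw_grad x2 w2; have [l _ lE] := dual_elem_linear gw_dual.
have -> : dG x1 w1 p1 q1 - dG x2 w2 p2 q2 =
    (ip (gx x2 w2) (p1 - p2) + gw x2 w2 (q1 - q2)) +
    (ip (gx x1 w1 - gx x2 w2) p1 + (gw x1 w1 q1 - gw x2 w2 q1)).
  by rewrite /total_diff (ipBr ip_inner) (ipBl ip_inner) lE linearB /=; ring.
have dp : `|ip (gx x2 w2) (p1 - p2)| <= K0 * `|p1 - p2|.
  by rewrite (le_trans (ip_cauchy_schwarz ip_inner _ _)) // ler_wpM2r.
have dgx : `|ip (gx x1 w1 - gx x2 w2) p1| <=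
    C0 * (`|x1 - x2| + `|w1 - w2|) * `|p1|.
  by rewrite (le_trans (ip_cauchy_schwarz ip_inner _ _)) // ler_wpM2r.
have dq := gw_le x2 w2 (q1 - q2); have dgw := gw_lip x1 w1 x2 w2 q1.
rewrite (le_trans (ler_normD _ _)) //; apply: lerD.
  by rewrite (le_trans (ler_normD _ _)) // lerD.
rewrite (le_trans (ler_normD _ _)) // mulrDl ![_ * _ * (_ + _)]mulrAC.
exact: lerD.
Qed.

Lemma gw_bound_ge0 (q : W) : 0 <= K1 * `|q|.
Proof. exact: le_trans (normr_ge0 _) (gw_le 0 0 q). Qed.

Lemma velocity_bound_ge0 (p : X) (q : W) : 0 <= `|p| + K1 * `|q| / c.
Proof. by rewrite addr_ge0 // divr_ge0 ?gw_bound_ge0 // ltW. Qed.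

Lemma total_diff_div_le x w p q : c <= `|gx x w| ->
  `|dG x w p q| / `|gx x w| <= `|p| + K1 * `|q| / c.
Proof.
move=> ca; have a_gt0 : 0 < `|gx x w| := lt_le_trans c_gt0 ca.
rewrite ler_pdivrMr // (le_trans (total_diff_le _ _ _ _)) // mulrDl.
rewrite lerD // 1?mulrC // mulrC -mulrA ler_peMr ?gw_bound_ge0 // mulrC.
by rewrite ler_pdivlMr // mul1r.
Qed.

Lemma velocity_law_inactive x w du dw dxi :
  law x w du dw dxi -> G x w < 1 -> dxi = 0.
Proof. by move=> [[]//|[->]]; rewrite ltxx. Qed.

Lemma velocity_law_active x w du dw dxi :
  law x w du dw dxi -> G x w = 1 ->
  0 <= dG x w du dw /\ dxi = dG x w du dw *: inversion (gx x w).
Proof. by move=> [[Glt _] GE|[]//]; rewrite GE ltxx in Glt. Qed.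

Lemma velocity_law_stationary x w du dw dxi :
  law x w du dw dxi -> G x w = 1 -> dG x w (du - dxi) dw = 0.
Proof.
move=> xlaw G1; have [_ ->] := velocity_law_active xlaw G1.
by rewrite total_diff_subr_inversion // -normr_gt0 (lt_le_trans c_gt0) // gx_ge.
Qed.

Lemma velocity_law_norm_le x w du dw dxi :
  law x w du dw dxi -> G x w = 1 -> `|dxi| <= c^-1 * dG x w du dw.
Proof.
move=> xlaw G1; have [rate_ge0 ->] := velocity_law_active xlaw G1.
rewrite normrZ normr_inversion ger0_norm // mulrC ler_wpM2r //.
by rewrite lef_pV2 ?posrE ?(lt_le_trans c_gt0) // gx_ge.
Qed.

Lemma velocity_law_dist_inactive x1 w1 x2 w2 du1 dw1 du2 dw2 dxi1 dxi2 :
  law x1 w1 du1 dw1 dxi1 -> law x2 w2 du2 dw2 dxi2 -> G x1 w1 < 1 ->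
  `|dxi1 - dxi2| + c^-1 * (Num.sg (G x1 w1 - G x2 w2) *
    (dG x1 w1 (du1 - dxi1) dw1 - dG x2 w2 (du2 - dxi2) dw2)) <=
  c^-1 * `|dG x1 w1 du1 dw1 - dG x2 w2 du2 dw2|.
Proof.
move=> law1 law2 G1; rewrite (velocity_law_inactive law1 G1).
have cV_ge0 : 0 <= c^-1 by rewrite invr_ge0 ltW.
have [[_ ->]|[G2 _ _]] := law2.
  rewrite !subr0 normr0 add0r ler_wpM2l // (le_trans (ler_norm _)) // normrM.
  by rewrite ler_piMl // normr_sg; case: (_ != _).
rewrite (velocity_law_stationary law2 G2).
rewrite G2 ltr0_sg ?subr_lt0 // mulN1r !subr0 sub0r normrN mulrN.
rewrite (le_trans (lerB (velocity_law_norm_le law2 G2) (lexx _))) //.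
by rewrite -mulrBr ler_wpM2l // distrC ler_norm.
Qed.

Lemma velocity_law_dist_active x1 w1 x2 w2 du1 dw1 du2 dw2 dxi1 dxi2 :
  law x1 w1 du1 dw1 dxi1 -> law x2 w2 du2 dw2 dxi2 ->
  G x1 w1 = 1 -> G x2 w2 = 1 ->
  `|dxi1 - dxi2| <=
  c^-1 * `|dG x1 w1 du1 dw1 - dG x2 w2 du2 dw2| +
  (`|du1| + K1 * `|dw1| / c) * (`|gx x1 w1 - gx x2 w2| / c).
Proof.
move=> law1 law2 G1 G2.
have [_ ->] := velocity_law_active law1 G1.
have [_ ->] := velocity_law_active law2 G2.
have a1_gt0 : 0 < `|gx x1 w1| := lt_le_trans c_gt0 (gx_ge G1).
have a2_gt0 : 0 < `|gx x2 w2| := lt_le_trans c_gt0 (gx_ge G2).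
have a2V_le : `|gx x2 w2|^-1 <= c^-1 by rewrite lef_pV2 ?posrE ?gx_ge.
rewrite (le_trans (dist_scaled_inversion_le ip_inner _ _ _ _)) -?normr_gt0 //.
rewrite addrC; apply: lerD; first by rewrite mulrC ler_wpM2r.
apply: ler_pM; rewrite ?divr_ge0 //; last by rewrite ler_wpM2l.
by rewrite total_diff_div_le // gx_ge.
Qed.

Lemma velocity_law_dist x1 w1 x2 w2 du1 dw1 du2 dw2 dxi1 dxi2 :
  law x1 w1 du1 dw1 dxi1 -> law x2 w2 du2 dw2 dxi2 ->
  `|dxi1 - dxi2| + c^-1 * (Num.sg (G x1 w1 - G x2 w2) *
    (dG x1 w1 (du1 - dxi1) dw1 - dG x2 w2 (du2 - dxi2) dw2)) <=
  c^-1 * `|dG x1 w1 du1 dw1 - dG x2 w2 du2 dw2| +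
  (`|du1| + K1 * `|dw1| / c) * (`|gx x1 w1 - gx x2 w2| / c).
Proof.
move=> law1 law2.
have gx_term_ge0 : 0 <= (`|du1| + K1 * `|dw1| / c) * (`|gx x1 w1 - gx x2 w2| / c).
  by rewrite mulr_ge0 ?velocity_bound_ge0 // divr_ge0 // ltW.
have [[G1 _]|[G1 _ _]] := law1; last have [[G2 _]|[G2 _ _]] := law2.
- by rewrite -[leLHS]addr0 lerD // velocity_law_dist_inactive.
- have := velocity_law_dist_inactive law2 law1 G2.
  rewrite distrC (distrC (dG x2 _ _ _)) -(opprB (G x1 w1)) sgrN.
  rewrite -(opprB (dG x1 _ _ _)) mulrNN => dist21.
  by rewrite -[leLHS]addr0 lerD.
- rewrite G1 G2 subrr sgr0 mul0r mulr0 addr0.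
  exact: velocity_law_dist_active.
Qed.

Lemma velocity_law_estimate x1 w1 x2 w2 du1 dw1 du2 dw2 dxi1 dxi2 :
  law x1 w1 du1 dw1 dxi1 -> law x2 w2 du2 dw2 dxi2 ->
  `|dxi1 - dxi2| + c^-1 * (Num.sg (G x1 w1 - G x2 w2) *
    (dG x1 w1 (du1 - dxi1) dw1 - dG x2 w2 (du2 - dxi2) dw2)) <=
  c^-1 * (K0 * `|du1 - du2| + K1 * `|dw1 - dw2|) +
  c^-1 * (2 * C0 * `|du1| + (C1 + C0 * K1 / c) * `|dw1|) *
    (`|w1 - w2| + `|x1 - x2|).
Proof.
move=> law1 law2; apply: (le_trans (velocity_law_dist law1 law2)).
have rate_dist : c^-1 * `|dG x1 w1 du1 dw1 - dG x2 w2 du2 dw2| <=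
    c^-1 * (K0 * `|du1 - du2| + K1 * `|dw1 - dw2| +
      (C0 * `|du1| + C1 * `|dw1|) * (`|x1 - x2| + `|w1 - w2|)).
  by rewrite ler_wpM2l ?invr_ge0 ?total_diff_dist_le // ltW.
have gx_dist : (`|du1| + K1 * `|dw1| / c) * (`|gx x1 w1 - gx x2 w2| / c) <=
    (`|du1| + K1 * `|dw1| / c) * (C0 * (`|x1 - x2| + `|w1 - w2|) / c).
  by rewrite ler_wpM2l ?velocity_bound_ge0 // ler_wpM2r // invr_ge0 ltW.
apply: (le_trans (lerD rate_dist gx_dist)).
by rewrite le_eqVlt; apply/orP; left; apply/eqP; ring.
Qed.

Lemma sweeping_solution_ae (r T : R) (u xi : R -> X) (w : R -> W) (x0 : X) :
  W11 T u -> W11 T w -> sweeping_solution ip G r T u w x0 xi ->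
  {ae (@lebesgue_measure R), forall t, t \in `]0, T[ ->
    is_derive t 1 (fun s => G (u s - xi s) (w s))
      (dG (u t - xi t) (w t) (derive1 u t - derive1 xi t) (derive1 w t)) /\
    law (u t - xi t) (w t) (derive1 u t) (derive1 w t) (derive1 xi t)}.
Proof.
move=> Wu Ww [Wxi xZ normal _].
have ae_filter := ae_filter_ringOfSetsType (@lebesgue_measure R).
have ud := ae_is_derive1 Wu; have wd := ae_is_derive1 Ww.
have xid := ae_is_derive1 Wxi.
near=> t => t0T.
have udt : is_derive t 1 u (derive1 u t) by move: t0T; near: t; exact: ud.
have wdt : is_derive t 1 w (derive1 w t) by move: t0T; near: t; exact: wd.
have xidt : is_derive t 1 xi (derive1 xi t) by move: t0T; near: t; exact: xid.
split; first exact: is_derive_constraint (is_deriveB udt xidt) wdt.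
apply: (sweeping_velocity_law (k := `|derive1 xi t| / (2 * r)) udt xidt wdt).
  apply: filterS (near_in_itvoo t0T) => s s0T; apply: xZ.
  exact: subset_itv_oo_cc.
by move: t0T; near: t; exact: normal.
Unshelve. all: by end_near. Qed.

End sweeping.

Theorem theorem3p4 (R : realType)
  (X : completeNormedModType R) (ip : X -> X -> R) (Hip : inner_product ip)
  (W : completeNormedModType R)
  (G : X -> W -> R) (HG0 : forall x w, 0 <= G x w) (HGloc : locally_lipschitz2 G)
  (gx : X -> W -> X) (Hgx : is_grad_x ip G gx)
  (gw : X -> W -> W -> R) (Hgw : is_grad_w G gw)
  (* hypothesis (H) *)
  (lambda c L : R) (Hlambda : 0 < lambda) (Hc : 0 < c) (HL : 0 < L)
  (mu1 : W -> R -> R) (mu2 : R -> R)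
  (Hmu1pos : forall w s, 0 <= s -> 0 <= mu1 w s)
  (Hmu2pos : forall s, 0 <= s -> 0 <= mu2 s)
  (Hmu10 : forall w, mu1 w 0 = 0) (Hmu20 : mu2 0 = 0)
  (Hmu1oo : forall w, mu1 w x @[x --> +oo] --> +oo)
  (Hmu2oo : mu2 x @[x --> +oo] --> +oo)
  (HHi : forall x w, G x w = 1 -> c <= `|gx x w|)
  (HHii : forall x y w, Zset G w x -> Zset G w y ->
            `|gx x w - gx y w| <= mu1 w `|x - y|)
  (HHiii : forall x z w, bdry (Zset G w) x -> Zset G w z ->
            - lambda * `|x - z| ^+ 2 <= ip (gx x w - gx z w) (x - z))
  (HHiv : forall x w w', `|G x w - G x w'| <= L * `|w - w'|)
  (HHv : forall x w rho, 0 < rho -> (rho%:E <= dist_set x (Zset G w))%E ->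
            mu2 rho <= G x w - 1)
  (* hypothesis (L) *)
  (K0 K1 C0 C1 : R) (HK0 : 0 < K0) (HK1 : 0 < K1) (HC0 : 0 < C0) (HC1 : 0 < C1)
  (HLK0 : forall x w, `|gx x w| <= K0)
  (HLK1 : forall x w, dual_norm_le (gw x w) K1)
  (HLC0 : forall x w x' w', `|gx x w - gx x' w'| <= C0 * (`|x - x'| + `|w - w'|))
  (HLC1 : forall x w x' w',
            dual_norm_le (fun v => gw x w v - gw x' w' v) (C1 * (`|x - x'| + `|w - w'|)))
  (* data *)
  (T : R) (HT : 0 < T)
  (u1 u2 : R -> X) (w1 w2 : R -> W) (x10 x20 : X) (xi1 xi2 : R -> X)
  (Hu1 : W11 T u1) (Hu2 : W11 T u2) (Hw1 : W11 T w1) (Hw2 : W11 T w2)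
  (Hx10 : Zset G (w1 0) x10) (Hx20 : Zset G (w2 0) x20)
  (Hxi1 : sweeping_solution ip G (c / lambda) T u1 w1 x10 xi1)
  (Hxi2 : sweeping_solution ip G (c / lambda) T u2 w2 x20 xi2) :
  {ae (@lebesgue_measure R), forall t, t \in `]0, T[ ->
    let g := fun s => `|G (u1 s - xi1 s) (w1 s) - G (u2 s - xi2 s) (w2 s)| in
    derivable g t 1 /\
    `|derive1 xi1 t - derive1 xi2 t| + c^-1 * derive1 g t
      <= c^-1 * (K0 * `|derive1 u1 t - derive1 u2 t|
                 + K1 * `|derive1 w1 t - derive1 w2 t|)
         + c^-1 * (2 * C0 * `|derive1 u1 t| + (C1 + C0 * K1 / c) * `|derive1 w1 t|)
           * (`|w1 t - w2 t| + `|(u1 t - xi1 t) - (u2 t - xi2 t)|)}.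
Proof.
have solution_ae := sweeping_solution_ae Hip Hc Hgx Hgw HHi HLC0 HLC1.
have sol1 := solution_ae _ _ _ _ _ _ Hu1 Hw1 Hxi1.
have sol2 := solution_ae _ _ _ _ _ _ Hu2 Hw2 Hxi2.
pose f s := G (u1 s - xi1 s) (w1 s) - G (u2 s - xi2 s) (w2 s).
have f_zero := ae_derive_eq0_at_zeros f.
apply: (filterS3 (ae_filter_ringOfSetsType _) _ sol1 sol2 f_zero).
move=> {f_zero} t sol1t sol2t f_zero t0T; set g := (X in derivable X _ _).
have [G1d law1] := sol1t t0T; have [G2d law2] := sol2t t0T.
have fd := is_deriveB G1d G2d; have gd := is_derive_normr fd (f_zero _ fd).
split; first by case: gd.
rewrite (derive1E g) (derive_val (is_derive := gd)).
exact: (velocity_law_estimate Hip Hc Hgw HHi HLK0 HLK1 HLC0 HLC1).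
Qed.
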